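(* Let $c:\{0,1\}^n\to\mathbb{R}$ be an efficiently classically evaluable cost function with cost Hamiltonian $C=a_0I+C_Z$, $C_Z$ traceless and $C_Z\neq0$, $C\ne 0$. Fix $0<\varepsilon<1$ and let $\gamma,\beta\in\mathbb{R}$ satisfy $$|\beta|\le\frac25\,\frac{\sqrt{\varepsilon}}{n},\qquad |\gamma|\le\frac{\varepsilon^{1/4}}{2\min(\|C_Z\|,\|C\|)} .$$ Then there exists an efficient classical randomized algorithm producing each bitstring $x\in\{0,1\}^n$ with a probability $P_{class}(x)$ which satisfies $$|P_{class}(x)-P_1(x)|\le\frac{\varepsilon}{2^n},$$ and whose expected value of the cost function $\langle c\rangle_{class}=\sum_xP_{class}(x)c(x)$ satisfies $$|\langle c\rangle_{class}-\langle C\rangle_1|<\|C_Z\|\,\varepsilon ,$$ where $P_1(x)$ and $\langle C\rangle_1$ are the measurement probabilities and cost expectation of QAOA$_1$ with parameters $\gamma,\beta$.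
   Context: Work on $n$ qubits with computational basis $\{|x\rangle : x\in\{0,1\}^n\}$. The cost Hamiltonian is $C=\sum_xc(x)|x\rangle\langle x|$; $a_0=2^{-n}\sum_xc(x)$ and $C_Z=C-a_0I$. $\|\cdot\|$ is the spectral norm. $B=\sum_{j=1}^nX_j$, $|s\rangle=2^{-n/2}\sum_x|x\rangle$. The QAOA$_1$ state is $|\gamma\beta\rangle=e^{-i\beta B}e^{-i\gamma C}|s\rangle$, $P_1(x)=|\langle x|\gamma\beta\rangle|^2$, $\langle C\rangle_1=\langle\gamma\beta|C|\gamma\beta\rangle$. ''Efficient'' means running in time polynomial in $n$, given that $c(x)$ can be efficiently evaluated classically. *)

(* Defs.v *)
(* MathComp + MathComp-Analysis. *)
From HB Require Import structures.
From mathcomp Require Import all_boot all_order all_algebra.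
From mathcomp Require Import all_classical all_reals all_analysis.
From mathcomp Require Import complex.
Set Implicit Arguments.
Unset Strict Implicit.
Unset Printing Implicit Defensive.
Import Order.TTheory GRing.Theory Num.Theory.
Import numFieldNormedType.Exports.

Local Open Scope classical_set_scope.
Local Open Scope complex_scope.
Local Open Scope ring_scope.

Definition bits (n : nat) := {ffun 'I_n -> bool}.

Notation qdim n := #|{: bits n}|.

Definition flip (n : nat) (j : 'I_n) (x : bits n) : bits n :=
  [ffun k => if k == j then ~~ x k else x k].

Section Quantum.
Variable R : realType.

(* Power series of the exponential, with the limit of the partial sums taken
   separately on the real and imaginary parts of each entry. *)
Definition mxexp_psum (N : nat) (A : 'M[R[i]]_N) (k : nat) : 'M[R[i]]_N :=
  \sum_(m < k) (m`!%:R)^-1 *: A ^+ m.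

Definition mxexp (N : nat) (A : 'M[R[i]]_N) : 'M[R[i]]_N :=
  \matrix_(i, j) (limn (fun k => complex.Re (mxexp_psum A k i j))
              +i* limn (fun k => complex.Im (mxexp_psum A k i j))).

Definition l2norm (N : nat) (v : 'cV[R[i]]_N) : R :=
  Num.sqrt (\sum_i Normc.normc (v i 0) ^+ 2).

Definition specnorm (N : nat) (A : 'M[R[i]]_N) : R :=
  sup [set l2norm (A *m v) | v in [set v : 'cV[R[i]]_N | l2norm v <= 1]].

Definition braket (N : nat) (u v : 'cV[R[i]]_N) : R[i] :=
  (((map_mx (@conjc R) u)^T) *m v) 0 0.

Variable n : nat.

(* The matrix index of the basis vector |x> is [enum_rank x]. *)
Definition ket (x : bits n) : 'cV[R[i]]_(qdim n) := delta_mx (enum_rank x) 0.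

Definition costH (c : bits n -> R) : 'M[R[i]]_(qdim n) :=
  \sum_x (c x)%:C *: (ket x *m (ket x)^T).

Definition cost_mean (c : bits n -> R) : R := (2 ^+ n)^-1 * \sum_x c x.

Definition costHZ (c : bits n -> R) : 'M[R[i]]_(qdim n) :=
  costH c - ((cost_mean c)%:C)%:M.

Definition pauliX (j : 'I_n) : 'M[R[i]]_(qdim n) :=
  \sum_x ket (flip j x) *m (ket x)^T.

Definition mixer : 'M[R[i]]_(qdim n) := \sum_j pauliX j.

Definition plus_state : 'cV[R[i]]_(qdim n) :=
  ((Num.sqrt (2 ^+ n))^-1)%:C *: \sum_x ket x.

Definition qaoa1_state (c : bits n -> R) (gamma beta : R) :
    'cV[R[i]]_(qdim n) :=
  mxexp ((0 -i* beta) *: mixer) *m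
    (mxexp ((0 -i* gamma) *: costH c) *m plus_state).

Definition qaoa1_prob (c : bits n -> R) (gamma beta : R) (x : bits n) : R :=
  Normc.normc (braket (ket x) (qaoa1_state c gamma beta)) ^+ 2.

Definition qaoa1_mean (c : bits n -> R) (gamma beta : R) : R[i] :=
  let psi := qaoa1_state c gamma beta in braket psi (costH c *m psi).

End Quantum.

(* Probabilistic random-access machine over the reals.  It has index registers
   (natural numbers, only incremented, decremented, copied and compared), a bit
   memory and a real memory, both indirectly addressed by index registers, and
   exact real arithmetic.  Jump targets are absolute; the machine halts when the
   program counter leaves the program. *)
Inductive arith_op := OpAdd | OpSub | OpMul | OpDiv.

Inductive instr :=
| IZero of nat                        (* idx k := 0 *)
| ISucc of nat                        (* idx k := idx k + 1 *)
| IPred of nat                        (* idx k := idx k - 1, truncated *)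
| ICopy of nat & nat                  (* idx k := idx l *)
| BSet of nat & bool                  (* bit (idx k) := b *)
| RConst of nat & int                 (* reg i := z *)
| RArith of arith_op & nat & nat & nat (* reg i := reg j op reg k *)
| RLoad of nat & nat                  (* reg i := reg (idx k) *)
| RStore of nat & nat                 (* reg (idx k) := reg i *)
| RQuery of nat          (* reg i := cost of the word in bit cells 0..n-1 *)
| Jump of nat
| JumpEq of nat & nat & nat           (* jump to l if idx j = idx k *)
| JumpBit of nat & nat                (* jump to l if bit (idx k) *)
| JumpLt of nat & nat & nat           (* jump to l if reg i < reg j *)
| Coin of nat & nat.     (* jump to l with probability reg i clamped to [0,1] *)

Definition program := seq instr.

Definition deterministic (p : program) : bool :=
  all (fun a => if a is Coin _ _ then false else true) p.
Definition query_free (p : program) : bool :=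
  all (fun a => if a is RQuery _ then false else true) p.

Definition poly_bounded (t : nat -> nat) : Prop :=
  exists k : nat, forall n : nat, (t n <= n ^ k + k)%N.

Section Machine.
Variable R : realType.

Record config := Config {
  pc : nat;
  idx : nat -> nat;
  bit : nat -> bool;
  reg : nat -> R;
  clock : nat (* time elapsed *)
}.

Definition upd (T : Type) (f : nat -> T) (k : nat) (v : T) : nat -> T :=
  fun i => if i == k then v else f i.

Definition word (n : nat) (s : config) : bits n :=
  [ffun i : 'I_n => bit s i].

Definition arith (o : arith_op) (x y : R) : R :=
  match o with
  | OpAdd => x + y | OpSub => x - y | OpMul => x * y | OpDiv => x / y
  end.

Definition clamp01 (x : R) : R := Num.max 0 (Num.min 1 x).

(* One instruction, as a list of weighted successors.  Every instruction takes
   one unit of time, except that a query is charged [tq] more, the time spent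
   evaluating the cost function [c]. *)
Definition exec (n : nat) (c : bits n -> R) (tq : nat) (a : instr)
    (s : config) : seq (R * config) :=
  let: Config pc idx bit reg t := s in
  let next idx' bit' reg' := [:: (1, Config pc.+1 idx' bit' reg' t.+1)] in
  let goto l := Config l idx bit reg t.+1 in
  let branch (b : bool) l := [:: (1, goto (if b then l else pc.+1))] in
  match a with
  | IZero k => next (upd idx k 0%N) bit reg
  | ISucc k => next (upd idx k (idx k).+1) bit reg
  | IPred k => next (upd idx k (idx k).-1) bit reg
  | ICopy k l => next (upd idx k (idx l)) bit reg
  | BSet k b => next idx (upd bit (idx k) b) reg
  | RConst i z => next idx bit (upd reg i z%:~R)
  | RArith o i j k => next idx bit (upd reg i (arith o (reg j) (reg k)))
  | RLoad i k => next idx bit (upd reg i (reg (idx k)))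
  | RStore k i => next idx bit (upd reg (idx k) (reg i))
  | RQuery i =>
      [:: (1, Config pc.+1 idx bit (upd reg i (c (word n s))) (t.+1 + tq)%N)]
  | Jump l => branch true l
  | JumpEq j k l => branch (idx j == idx k) l
  | JumpBit k l => branch (bit (idx k)) l
  | JumpLt i j l => branch (reg i < reg j) l
  | Coin i l => let w := clamp01 (reg i) in
      [:: (w, goto l); (1 - w, goto pc.+1)]
  end.

Definition halted (p : program) (s : config) : bool := (size p <= pc s)%N.

Definition step (n : nat) (c : bits n -> R) (tq : nat) (p : program)
    (s : config) : seq (R * config) :=
  if halted p s then [:: (1, s)] else exec c tq (nth (Jump 0) p (pc s)) s.

(* Probability that [E] holds after [k] steps from [s]. *)
Fixpoint prob_after (n : nat) (c : bits n -> R) (tq : nat) (p : program)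
    (E : config -> bool) (k : nat) (s : config) : R :=
  if k is k'.+1 then
    \sum_(o <- step c tq p s) o.1 * prob_after c tq p E k' o.2
  else (E s)%:R.

Definition done_in (p : program) (T : nat) (s : config) : bool :=
  halted p s && (clock s <= T)%N.

(* [c n] is computed within time [t n] by one deterministic program, started on
   n, the bitstring x, and a description [w n] of the n-th instance (such as
   the weights of its terms) stored in the real memory. *)
Definition evaluable_in (c : forall n, bits n -> R) (t : nat -> nat) : Prop :=
  exists (p : program) (w : nat -> nat -> R),
    [/\ deterministic p, query_free p &
      forall (n : nat) (x : bits n),
        prob_after (fun _ : bits n => 0) 0 p
          (fun s => done_in p (t n) s && (reg s 0%N == c n x)) (t n)
          (Config 0 (upd (fun=> 0%N) 0 n)
             (fun i => if insub i is Some j then x j else false)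
             (w n) 0) = 1].

(* Program [p], with access to the cost function [c] at [tq] per evaluation and
   started on n, eps, gamma and beta, halts within time [T] with probability 1,
   leaving each bitstring [x] in bit cells 0..n-1 with probability [P x].
   As every step takes time at least 1, [T] steps suffice to observe this. *)
Definition produces (p : program) (n : nat) (c : bits n -> R) (tq : nat)
    (eps gamma beta : R) (T : nat) (P : bits n -> R) : Prop :=
  let s0 := Config 0 (upd (fun=> 0%N) 0 n) (fun=> false)
              (nth 0 [:: eps; gamma; beta]) 0 in
  prob_after c tq p (done_in p T) T s0 = 1 /\
  forall x : bits n,
    P x = prob_after c tq p (fun s => done_in p T s && (word n s == x)) T s0.

End Machine.

(* Main.v *)
(* To first order in beta, P_1(x) is
   2^-n (1 + 2 beta gamma sum_j (c(x) - c(x^j))), where x^j is x with bit j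
   flipped.  This is exactly the distribution obtained by drawing a uniform x
   and a uniform position j and then resetting bit j to 1 with probability
   1/2 + n beta gamma (c(x with x_j = 1) - c(x with x_j = 0)), which costs two
   evaluations of c.

   For the error, put g = eps^(1/4), so that n |beta| <= (2/5) g^2 and
   |gamma (c(y) - c(x))| <= g for all x, y.  Fix x and factor out the phase
   e^{-i gamma c(x)}: the phases of e^{-i gamma C} become 1 + w with w(x) = 0
   and |w| <= g, and e^{-i beta B} maps the constant 1 to e^{-i n beta}.  The
   terms of order at least 2 in beta carry a factor g (n beta)^2, and replacing
   sin u by u for u = gamma (c(x^j) - c(x)) costs |u|^3/6; together they stay
   below (9/10) eps / 2^n.  The slack gives the strict bound on the mean,
   because both distributions sum to 1 and |c - a_0| <= ||C_Z||.  That P_1 sums to 1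
   comes from diagonalizing B in the Walsh-Hadamard basis. *)

Require Import Defs.
From mathcomp Require Import all_boot all_order all_algebra.
From mathcomp Require Import all_classical all_reals all_analysis.
From mathcomp Require Import complex ring lra zify.
Import Order.TTheory GRing.Theory Num.Theory.
Import numFieldNormedType.Exports.
Set Implicit Arguments.
Unset Strict Implicit.
Unset Printing Implicit Defensive.
Local Open Scope classical_set_scope.
Local Open Scope complex_scope.
Local Open Scope ring_scope.
Import Normc.

(** * Polynomial bounds and the sampling program *)

Lemma poly_bounded_const m : poly_bounded (fun=> m).
Proof. by exists m => n; rewrite leq_addl. Qed.

Lemma poly_bounded_id : poly_bounded id.
Proof. by exists 1%N => n; rewrite expn1 leq_addr. Qed.

Lemma poly_boundedD t u :
  poly_bounded t -> poly_bounded u -> poly_bounded (fun n => t n + u n)%N.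
Proof.
(* The 2 in the exponent supplies a factor n^2 >= 4 for n >= 2; the 2 in the additive constant
   covers n = 0, where 0^0 = 1. *)
move=> [k hk] [l hl]; exists (k + l + 2)%N => n.
apply: leq_trans (leq_add (hk n) (hl n)) _.
case: n => [|[|n]].
- have h0 m : (0 ^ m <= 1)%N by case: m => // m; rewrite exp0n.
  by have := h0 k; have := h0 l; lia.
-
 by rewrite !exp1n; lia.
- suff : (n.+2 ^ k + n.+2 ^ l <= n.+2 ^ (k + l + 2))%N by lia.
have hX m : (m <= k + l -> n.+2 ^ m <= n.+2 ^ (k + l))%N.
  by move=> hm; rewrite leq_exp2l.
have := hX k (leq_addr _ _); have := hX l (leq_addl _ _).
have h4 : (4 <= n.+2 ^ 2)%N by rewrite -[4%N]/(2 ^ 2)%N leq_exp2r.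
rewrite [(_ ^ (_ + 2))%N]expnD; move: h4.
move: (n.+2 ^ 2)%N (n.+2 ^ k)%N (n.+2 ^ l)%N (n.+2 ^ (k + l))%N => a b d e.
by nia.
Qed.

Lemma poly_boundedMl m t : poly_bounded t -> poly_bounded (fun n => m * t n)%N.
Proof.
move=> ht; elim: m => [|m IH]; first exact: poly_bounded_const.
exact: poly_boundedD.
Qed.

(** The position is a natural number because it is read off an index register. *)
Definition setb (n : nat) (j : nat) (b : bool) (x : bits n) : bits n :=
  [ffun k : 'I_n => if val k == j then b else x k].

Section BitSums.
Variables (R : realType) (n : nat).
Implicit Type x : bits n.

Lemma flipK (j : 'I_n) : involutive (@flip n j).
Proof.
by move=> x; apply/ffunP => k; rewrite !ffunE; case: eqP => // _; rewrite negbK.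
Qed.

Lemma sum_flip (V : nmodType) (j : 'I_n) (F : bits n -> V) :
  \sum_x F (flip j x) = \sum_x F x.
Proof. by rewrite [RHS](reindex_inj (inv_inj (flipK j))). Qed.

Lemma setb_cases (j : 'I_n) x :
  (setb j false x = x /\ setb j true x = flip j x) \/
  (setb j false x = flip j x /\ setb j true x = x).
Proof.
case hx: (x j); [right|left]; split; apply/ffunP => k;
  by rewrite !ffunE ?val_eqE; case: eqP => // ->; rewrite hx.
Qed.

Lemma sum_setb (j : 'I_n) (F : bits n -> R) :
  \sum_x (F (setb j false x) + F (setb j true x)) = 2 * \sum_x F x.
Proof.
transitivity (\sum_x (F x + F (flip j x))).
  apply: eq_bigr => x _.
  by case: (setb_cases j x) => -[-> ->] //; rewrite addrC.
by rewrite big_split /= sum_flip; ring.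
Qed.

End BitSums.

(* Index registers: 0 holds n, 1 the loop counter i, 2 the sampled position j.
   Real registers: 1 gamma, 2 beta, 3 the number of rounds done, 4 the constant
   1/2, 5 the constant 1.  Round i replaces j by i with probability 1/(i+1), so
   that j ends up uniform.  The comments give the program addresses. *)
Definition sampler : program := [::
  (*  0 *) RConst 5 1; RConst 4 2; RArith OpDiv 4 5 4;
  (*  3 *) JumpEq 1 0 14;
  (*  4 *) BSet 1 true; Coin 4 7; BSet 1 false;
  (*  7 *) RArith OpAdd 3 3 5; RArith OpDiv 6 5 3; Coin 6 11; Jump 12;
  (* 11 *) ICopy 2 1; ISucc 1; Jump 3;
  (* 14 *) BSet 2 false; RQuery 7; BSet 2 true; RQuery 8;
  (* 18 *) RArith OpSub 7 8 7; RArith OpMul 7 7 1; RArith OpMul 7 7 2;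
  (* 21 *) RArith OpMul 7 7 3; RArith OpAdd 7 7 4; Coin 7 25;
  (* 24 *) BSet 2 false].

(** * Step-by-step analysis of the sampling program *)

Section Sampler.
Variables (R : realType) (n : nat) (c : bits n -> R) (tq : nat).
Variables (gamma beta : R) (T : nat) (P : pred (bits n)).

(** [P] stays arbitrary: [predT] will give halting with probability 1, and [pred1 y] the probability
    of the output y. *)
Let E (s : config R) := done_in sampler T s && P (word n s).
Let pr := prob_after c tq sampler E.

Lemma pr_step k s : pr k.+1 s = \sum_(o <- step c tq sampler s) o.1 * pr k o.2.
Proof. by []. Qed.

(** A halted configuration steps to itself, so a surplus of steps is harmless. *)
Lemma pr_halted k s : halted sampler s -> pr k s = (E s)%:R.
Proof.
by move=> hs; elim: k => //= k <-; rewrite pr_step /step hs big_seq1 mul1r.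
Qed.

(** Probability that the last coin leaves bit [j] true; it is independent of the value of that bit
    in [x]. *)
Definition flip_prob (x : bits n) (j : nat) : R :=
  2^-1 + n%:R * beta * gamma * (c (setb j true x) - c (setb j false x)).

Hypothesis flip_prob01 : forall x j, (j < n)%N -> 0 <= flip_prob x j <= 1.

Definition outcome (x : bits n) (j : nat) : R :=
  flip_prob x j * (P (setb j true x))%:R
  + (1 - flip_prob x j) * (P (setb j false x))%:R.

Lemma clamp01_id (x : R) : 0 <= x <= 1 -> clamp01 x = x.
Proof. by move=> /andP[h0 h1]; rewrite /clamp01 min_r // max_r. Qed.

Ltac onestep :=
  rewrite pr_step /step /= ?big_cons ?big_nil /= ?mul1r ?addr0; rewrite /upd /=.

Lemma word_upd j b pc idx bit (reg : nat -> R) t :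
  word n (Config pc idx (fun i => if i == j then b else bit i) reg t)
  = setb j b (word n (Config pc idx bit reg t)).
Proof. by apply/ffunP => i; rewrite !ffunE. Qed.

Lemma wordE pc idx bit (reg : nat -> R) t :
  word n (Config pc idx bit reg t) = [ffun i : 'I_n => bit i].
Proof. by []. Qed.

Lemma setb_setb j b b' (x : bits n) : setb j b (setb j b' x) = setb j b x.
Proof. by apply/ffunP => i; rewrite !ffunE; case: eqP. Qed.

(** Addresses 14 to 24 hold 11 instructions, two of them queries; hence the 11 steps and the time 11
    + 2 [tq]. *)
Lemma pr_final k idx bit reg t :
  (idx 2 < n)%N -> reg 1%N = gamma -> reg 2%N = beta -> reg 3%N = n%:R ->
  reg 4%N = 2^-1 -> (t + 2 * tq + 11 <= T)%N ->
  pr (k + 11) (Config 14 idx bit reg t)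
  = outcome [ffun i : 'I_n => bit i] (idx 2%N).
Proof.
move=> hj h1 h2 h3 h4 hT; rewrite addnC.
do 2 onestep; rewrite word_upd wordE.
do 2 onestep; rewrite !word_upd setb_setb wordE.
do 5 onestep.
rewrite h1 h2 h3 h4.
onestep.
set w := (X in clamp01 X).
have -> : w = flip_prob [ffun i : 'I_n => bit i] (idx 2%N).
  by rewrite /w /flip_prob; ring.
rewrite clamp01_id; last exact: flip_prob01.
rewrite [X in _ * X + _]pr_halted //.
onestep.
rewrite !pr_halted // /E /done_in /= !word_upd !setb_setb wordE.
clear w.
have hle m : (m <= t + 2 * tq + 11 -> m <= T)%N by move/leq_trans; apply.
by rewrite !hle //; clear; lia.
Qed.

(* Mean of [outcome] over the final value of j, given that it is j after i
   rounds. *)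
Definition mean_outcome (i j : nat) (x : bits n) : R :=
  i%:R / n%:R * outcome x j + n%:R^-1 * \sum_(i <= l < n) outcome x l.

(** Reservoir sampling: the current [j] keeps weight (1 - 1/(i+1)) (i+1)/n = i/n, and the candidate
    [i] gets 1/(i+1) times (i+1)/n, that is 1/n, the first term of the tail sum. *)
Lemma mean_outcome_step i j x : (i < n)%N ->
  i.+1%:R^-1 * mean_outcome i.+1 i x + (1 - i.+1%:R^-1) * mean_outcome i.+1 j x
  = mean_outcome i j x.
Proof.
move=> hi; rewrite /mean_outcome [X in _ = _ + _ * X]big_ltn // -natr1.
by field; rewrite natr1 !pnatr_eq0 /= -lt0n (leq_ltn_trans _ hi).
Qed.

(** The bits below [i] are already drawn; averaging over [x] stands for the draws still to come. *)
Definition splice (i : nat) (bit : nat -> bool) (x : bits n) : bits n :=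
  [ffun k : 'I_n => if (k < i)%N then bit k else x k].

Lemma splice_upd i b bit x :
  splice i.+1 (fun k => if k == i then b else bit k) x
  = setb i b (splice i bit x).
Proof. by apply/ffunP => k; rewrite !ffunE ltnS; case: ltngtP. Qed.

Lemma splice_setb i b bit x :
  setb i b (splice i bit x) = splice i bit (setb i b x).
Proof. by apply/ffunP => k; rewrite !ffunE; case: ltngtP. Qed.

(** Both outcomes of the coin are back at address 3 after six steps, so the two branches share one
    clock. *)
Lemma pr_pick k idx bit reg t :
  reg 3%N = (idx 1%N)%:R -> reg 5%N = 1 ->
  let i := idx 1%N in
  let reg' := upd (upd reg 3 i.+1%:R) 6 i.+1%:R^-1 in
  pr k.+3.+3 (Config 7 idx bit reg t)
  = i.+1%:R^-1
      * pr k (Config 3 (upd (upd idx 2 i) 1 i.+1) bit reg' t.+3.+3)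
  + (1 - i.+1%:R^-1)
      * pr k (Config 3 (upd idx 1 i.+1) bit reg' t.+3.+3).
Proof.
move=> h3 h5 i reg'.
do 3 onestep.
rewrite h3 h5 natr1 div1r clamp01_id; last first.
  by rewrite invr_ge0 ler0n invf_le1 ?ltr0n // ler1n.
congr (_ * _ + _ * _); do 3 onestep; by rewrite /reg' /upd.
Qed.

(** Induction on the number [m] of rounds left. A round takes at most 10 steps; leaving the loop and
    finishing takes 1 + 11. *)
Lemma pr_loop m : forall k idx bit reg t,
  idx 0%N = n -> (idx 1%N + m)%N = n -> (idx 2 < n)%N ->
  reg 1%N = gamma -> reg 2%N = beta -> reg 3%N = (idx 1%N)%:R ->
  reg 4%N = 2^-1 -> reg 5%N = 1 ->
  (10 * m + 12 <= k)%N -> (t + 2 * tq + (10 * m + 12) <= T)%N ->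
  pr k (Config 3 idx bit reg t)
  = (2 ^+ n)^-1
    * \sum_x mean_outcome (idx 1%N) (idx 2%N) (splice (idx 1%N) bit x).
Proof.
elim: m => [|m IH] k idx bit reg t hn hi hj h1 h2 h3 h4 h5 hk hT.
  rewrite -(subnK hk) muln0 add0n.
  have {}hi : idx 1%N = n by rewrite -hi addn0.
  rewrite addnS; onestep.
  rewrite hn hi eqxx pr_final //; last 2 first.
  - by rewrite h3 hi.
  - by rewrite (leq_trans _ hT) //; clear; lia.
  (* With all bits drawn, [splice] no longer depends on [x], so the average is over a constant. *)
  rewrite (eq_bigr (fun=> outcome [ffun i : 'I_n => bit i] (idx 2%N))).
    rewrite big_const iter_addr addr0 card_ffun card_bool card_ord.
    by rewrite -[X in _ * X]mulr_natl natrX mulKf ?expf_neq0 ?pnatr_eq0.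
  move=> x _; rewrite /mean_outcome big_geq // mulr0 addr0 divff ?mul1r.
    by congr outcome; apply/ffunP => i; rewrite !ffunE ltn_ord.
  by rewrite pnatr_eq0 -lt0n (leq_ltn_trans _ hj).
have hin : (idx 1%N < n)%N by rewrite -hi; clear; lia.
(* The fresh bit is written and six steps lead back to address 3, hence 18 = 12 + 6. The two values
   of the bit arrive at different times, so [k'] and [t'] are left free. *)
have W k' bit' t' : (10 * m + 18 <= k')%N ->
    (t' + 2 * tq + (10 * m + 18) <= T)%N ->
    pr k' (Config 7 idx bit' reg t') = (2 ^+ n)^-1
    * \sum_x mean_outcome (idx 1%N) (idx 2%N) (splice (idx 1%N).+1 bit' x).
  move=> hk' ht'.
  have -> : k' = (k' - 6).+3.+3 by move: hk'; clear; lia.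
  rewrite pr_pick //.
  rewrite !IH /upd //=; try (by move: hi hk' ht'; clear; lia).
  rewrite mulrCA [X in _ + X]mulrCA -mulrDr; congr (_ * _).
  rewrite !mulr_sumr -big_split; apply: eq_bigr => x _.
  exact: mean_outcome_step.
have -> : k = (k - 4).+4 by move: hk; clear; lia.
onestep.
rewrite ifF; last by rewrite hn; move: hin; clear; lia.
do 2 onestep.
rewrite h4 clamp01_id; last by lra.
rewrite W; [|by move: hk hT; clear; lia..].
onestep.
rewrite W; [|by move: hk hT; clear; lia..].
have -> : 1 - 2^-1 = 2^-1 :> R by field.
rewrite -mulrDr -mulrDr -big_split /= mulrCA; congr (_ * _).
(* The two values of the fresh bit, each of weight 1/2, merge into the average over [x]. *)
rewrite -[RHS](mulKf (x := 2)) ?pnatr_eq0 // -(sum_setb (Ordinal hin)).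
congr (_ * _); apply: eq_bigr => x _ /=.
rewrite addrC -!splice_setb; congr (_ + _); congr mean_outcome.
  by apply/ffunP => l; rewrite !ffunE ltnS; case: ltngtP.
exact: splice_upd.
Qed.

(** Three steps load the constants, whence 15 = 12 + 3. The initial [j] enters the loop with weight
    0/n, so the final position is uniform. *)
Lemma pr_sampler k t : (0 < n)%N -> forall idx bit reg,
  idx 0%N = n -> idx 1%N = 0%N -> (idx 2 < n)%N ->
  reg 1%N = gamma -> reg 2%N = beta -> reg 3%N = 0 ->
  (10 * n + 15 <= k)%N -> (t + 2 * tq + (10 * n + 15) <= T)%N ->
  pr k (Config 0 idx bit reg t)
  = (2 ^+ n)^-1 * \sum_x n%:R^-1 * \sum_(j < n) outcome x j.
Proof.
move=> n0 idx bit reg hn hi hj h1 h2 h3 hk hT.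
have -> : k = (k - 3).+3 by move: hk; clear; lia.
do 3 onestep.
rewrite (pr_loop (m := n)) ?hi //=; try (by move: hk hT; clear; lia).
  congr (_ * _); apply: eq_bigr => x _.
  rewrite /mean_outcome mul0r mul0r add0r big_mkord; congr (_ * _).
  by apply: eq_bigr => j _; congr outcome; apply/ffunP => l; rewrite ffunE.
Qed.

End Sampler.

(** * Distribution of the classical output *)

Section Output.
Variables (R : realType) (n : nat) (c : bits n -> R) (tq : nat).
Variables (gamma beta : R).

Definition class_prob (x : bits n) : R :=
  (2 ^+ n)^-1 * (1 + 2 * beta * gamma * \sum_j (c x - c (flip j x))).

Hypothesis flip_prob01 : forall x j, (j < n)%N ->
  0 <= flip_prob c gamma beta x j <= 1.

Lemma sampler_produces eps : (0 < n)%N ->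
  produces sampler c tq eps gamma beta (10 * n + 15 + 2 * tq) class_prob.
Proof.
move=> n0; pose T := (10 * n + 15 + 2 * tq)%N.
have pE (P : pred (bits n)) : prob_after c tq sampler
    (fun s => done_in sampler T s && P (word n s)) T
    (Config 0 (upd (fun=> 0%N) 0 n) (fun=> false)
       (nth 0 [:: eps; gamma; beta]) 0)
    = (2 ^+ n)^-1 * \sum_x n%:R^-1 * \sum_(j < n) outcome c gamma beta P x j.
  by apply: pr_sampler => //; rewrite /T; clear; lia.
have n0' : n%:R != 0 :> R by rewrite pnatr_eq0 -lt0n.
split=> [|y].
  rewrite (_ : done_in _ _ = fun s => done_in sampler T s && predT (word n s)).
    rewrite pE (eq_bigr (fun=> 1)) => [|x _].
      by rewrite sumr_const card_ffun card_bool card_ord natrX mulVf //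
                 expf_neq0 // pnatr_eq0.
    rewrite (eq_bigr (fun=> 1)) => [|j _]; last by rewrite /outcome /=; ring.
    by rewrite sumr_const card_ord mulVf.
  by apply/funext => s; rewrite andbT.
rewrite (pE (pred1 y)) /class_prob -mulr_sumr exchange_big; congr (_ * _).
(* Flipping bit [j] negates the cost difference, so this one formula gives the weight of ending at
   [z] for both outcomes of the last coin. *)
pose F (j : 'I_n) z : R := (z == y)%:R
  * (2^-1 + n%:R * beta * gamma * (c z - c (flip j z))).
transitivity (n%:R^-1 * \sum_(j < n) 2 * \sum_z F j z).
  have FE j : \sum_z F j z
      = 2^-1 + n%:R * beta * gamma * (c y - c (flip j y)).
    rewrite (bigD1 y) //= big1 ?addr0 => [|z /negPf hz].
      by rewrite /F eqxx mul1r.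
    by rewrite /F hz mul0r.
  under [in RHS]eq_bigr do rewrite FE.
  rewrite -mulr_sumr.
  rewrite [in RHS]big_split /= sumr_const card_ord -mulr_sumr.
  rewrite -[2^-1 *+ n]mulr_natl.
  by field.
congr (_ * _); apply: eq_bigr => j _; rewrite -(sum_setb j).
apply: eq_bigr => x _.
rewrite /F /outcome /flip_prob /= addrC.
have -> : flip j (setb j true x) = setb j false x.
  by apply/ffunP => k; rewrite !ffunE -val_eqE; case: eqP.
have -> : flip j (setb j false x) = setb j true x.
  by apply/ffunP => k; rewrite !ffunE -val_eqE; case: eqP.
by field.
Qed.

(** Each flip permutes the bitstrings, so the cost differences cancel in the sum. *)
Lemma sum_class_prob : \sum_x class_prob x = 1.
Proof.
rewrite /class_prob -mulr_sumr big_split /= sumr_const card_ffun card_bool.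
rewrite card_ord natrX -mulr_sumr exchange_big /= big1 => [|j _].
  by rewrite mulr0 addr0 mulVf // expf_neq0 // pnatr_eq0.
by rewrite big_split /= sumrN sum_flip subrr.
Qed.

End Output.

(** * Trigonometric bounds and complex limits *)

Section SinBounds.
Variable R : realType.
Implicit Types x y : R.

Lemma le_sin x : 0 <= x -> sin x <= x.
Proof.
move=> x0; rewrite -subr_ge0.
have := @ger0_derive1_ndecr R (fun y => y - sin y) 0 x.
have dE y : is_derive y 1 (fun y : R => y - sin y) (1 - cos y).
  exact: is_deriveB.
move=> /(_ _ _ _ 0 x); rewrite sin0 subr0; apply => //.
- by move=> y _; rewrite derive1E derive_val subr_ge0 cos_le1.
- apply: continuous_subspaceT => y.
  by apply: cvgB; [exact: cvg_id|exact: continuous_sin].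
Qed.

Lemma norm_sin_le x : `|sin x| <= `|x|.
Proof.
wlog x0 : x / 0 <= x => [h|].
  have [|x0] := leP 0 x; first exact: h.
  by rewrite -normrN -sinN -[`|x|]normrN h // oppr_ge0 ltW.
rewrite [leRHS]ger0_norm // ler_norml le_sin // andbT.
have [x1|x1] := leP x 1.
  rewrite (le_trans _ (_ : 0 <= _)) ?oppr_le0 //.
  have [->|xn0] := eqVneq x 0; first by rewrite sin0.
  by apply/ltW/sin2_gt0; lra.
by have := sin_geN1 x; lra.
Qed.

(** Half-angle formula cos x = 1 - 2 sin^2 (x/2), with |sin (x/2)| <= |x/2|. *)
Lemma cos_ge x : 1 - x ^+ 2 / 2 <= cos x.
Proof.
pose y := x / 2; have -> : x = y + y by rewrite /y; field.
rewrite cosD -!expr2 cos2sin2.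
have := norm_sin_le y; rewrite -ler_sqr ?nnegrE // !real_normK ?num_real //.
by lra.
Qed.

(** The difference of the sides vanishes at 0 and has nonnegative derivative by [cos_ge]. *)
Lemma sin_ge x : 0 <= x -> x - x ^+ 3 / 6 <= sin x.
Proof.
move=> x0; rewrite -subr_ge0.
pose f (y : R) := sin y - (y - y ^+ 3 / 6).
have dE y : is_derive y 1 f (cos y - (1 - y ^+ 2 / 2)).
  rewrite /f; apply: is_derive_eq.
  by rewrite /GRing.scale /=; field.
have := @ger0_derive1_ndecr R f 0 x.
move=> /(_ _ _ _ 0 x); rewrite /f sin0 expr0n /= mul0r !subr0; apply => //.
- by move=> y _; rewrite derive1E derive_val subr_ge0 cos_ge.
- apply: continuous_subspaceT => y.
  by apply/differentiable_continuous/derivable1_diffP.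
Qed.

Lemma norm_sinB_le x : `|sin x - x| <= `|x| ^+ 3 / 6.
Proof.
wlog x0 : x / 0 <= x => [h|].
  have [|x0] := leP 0 x; first exact: h.
  have := h (- x); rewrite sinN normrN -opprD normrN; apply.
  by rewrite oppr_ge0 ltW.
rewrite [X in X ^+ 3]ger0_norm // ler_norml.
by have := le_sin x0; have := sin_ge x0; have := exprn_ge0 3 x0; lra.
Qed.

End SinBounds.

Section UnitCircle.
Variable R : realType.
Implicit Types (t : R) (z w : R[i]).

(* The sign is that of e^{-it}, as in the time evolution. *)
Definition cis t : R[i] := cos t -i* sin t.

Lemma normc_cis t : normc (cis t) = 1.
Proof. by rewrite /= sqrrN cos2Dsin2 sqrtr1. Qed.

Lemma cisD s t : cis (s + t) = cis s * cis t.
Proof. by rewrite /cis sinD cosD; simpc; congr (_ +i* _); ring. Qed.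

Lemma cis0 : cis 0 = 1.
Proof. by rewrite /cis sin0 cos0 oppr0. Qed.

(** The square of the left side is 2 - 2 cos t, at most t^2 by [cos_ge]. *)
Lemma normcB_cis1 t : normc (cis t - 1) <= `|t|.
Proof.
rewrite /cis; simpc => /=; rewrite -[leRHS]sqrtr_sqr ler_wsqrtr //.
have := cos_ge t; have := cos2Dsin2 t.
move: (cos t) (sin t) => x y; rewrite !expr2; nra.
Qed.

Lemma sqr_normc_mul z : (normc z ^+ 2)%:C = z^* * z.
Proof.
case: z => a b; rewrite /= sqr_sqrtr ?addr_ge0 ?sqr_ge0 //; simpc.
by congr (_ +i* _); ring.
Qed.

Lemma sqr_normc1D z : normc (1 + z) ^+ 2 = 1 + 2 * complex.Re z + normc z ^+ 2.
Proof.
case: z => a b; rewrite /= !sqr_sqrtr ?addr_ge0 ?sqr_ge0 //; ring.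
Qed.

Lemma norm_Re_le z : `|complex.Re z| <= normc z.
Proof.
case: z => a b /=; rewrite -sqrtr_sqr ler_wsqrtr // lerDl sqr_ge0 //.
Qed.

Lemma ReD z w : complex.Re (z + w) = complex.Re z + complex.Re w.
Proof. by case: z w => ? ? []. Qed.

Lemma ImD z w : complex.Im (z + w) = complex.Im z + complex.Im w.
Proof. by case: z w => ? ? []. Qed.

Lemma ReB z w : complex.Re (z - w) = complex.Re z - complex.Re w.
Proof. by case: z w => ? ? []. Qed.

Lemma normc_real t : normc t%:C = `|t|.
Proof. by rewrite /= expr0n addr0 sqrtr_sqr. Qed.

Lemma normc_ge0 z : 0 <= normc z.
Proof. by case: z => a b; exact: sqrtr_ge0. Qed.

Lemma normc_sum (I : Type) (r : seq I) (F : I -> R[i]) :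
  normc (\sum_(i <- r) F i) <= \sum_(i <- r) normc (F i).
Proof.
elim/big_ind2 : _ => [|a x b y hx hy|//]; first by rewrite normc0.
exact: le_trans (le_normcD _ _) (lerD hx hy).
Qed.

End UnitCircle.

(** * Complex limits and the scalar exponential series *)

Section ComplexLimits.
Variable R : realType.
Implicit Types (f : nat -> R[i]) (l z : R[i]).

(** Componentwise, to match the limits that define [mxexp]. *)
Definition ccvg f l :=
  (fun k => complex.Re (f k)) @ \oo --> complex.Re l
  /\ (fun k => complex.Im (f k)) @ \oo --> complex.Im l.

Lemma ccvg_cst l : ccvg (fun=> l) l.
Proof. by split; exact: cvg_cst. Qed.

Lemma ccvgD f g l m : ccvg f l -> ccvg g m -> ccvg (fun k => f k + g k) (l + m).
Proof.
move=> [fr fi] [gr gi]; rewrite /ccvg ReD ImD; split.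
  by under eq_fun do rewrite ReD; exact: cvgD.
by under eq_fun do rewrite ImD; exact: cvgD.
Qed.

Lemma ccvgM z f l : ccvg f l -> ccvg (fun k => z * f k) (z * l).
Proof.
case: z => a b [fr fi]; split.
  have -> : (fun k => complex.Re ((a +i* b) * f k)) =
      (fun k => a * complex.Re (f k) - b * complex.Im (f k)).
    by apply/funext => k; case: (f k).
  have -> : complex.Re ((a +i* b) * l) = a * complex.Re l - b * complex.Im l.
    by case: l {fr fi}.
  by apply: cvgB; apply: cvgMl_tmp.
have -> : (fun k => complex.Im ((a +i* b) * f k)) =
    (fun k => a * complex.Im (f k) + b * complex.Re (f k)).
  by apply/funext => k; case: (f k).
have -> : complex.Im ((a +i* b) * l) = a * complex.Im l + b * complex.Re l.
  by case: l {fr fi}.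
by apply: cvgD; apply: cvgMl_tmp.
Qed.

Lemma ccvg_sum (I : Type) (r : seq I) (F : I -> nat -> R[i]) (L : I -> R[i]) :
  (forall i, ccvg (F i) (L i)) ->
  ccvg (fun k => \sum_(i <- r) F i k) (\sum_(i <- r) L i).
Proof.
move=> h; elim: r => [|i r IH].
  by rewrite big_nil; under eq_fun do rewrite big_nil; exact: ccvg_cst.
by rewrite big_cons; under eq_fun do rewrite big_cons; exact: ccvgD.
Qed.

Lemma ccvg_lim f l : ccvg f l ->
  limn (fun k => complex.Re (f k)) +i* limn (fun k => complex.Im (f k)) = l.
Proof. by case: l => a b [/cvg_lim -> // /cvg_lim -> //]. Qed.

Lemma ccvg_unique f l m : ccvg f l -> ccvg f m -> l = m.
Proof. by move=> /ccvg_lim <- /ccvg_lim. Qed.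

Lemma ccvg_normc_le f l (B : R) : ccvg f l -> (forall k, normc (f k) <= B) ->
  normc l <= B.
Proof.
move=> [fr fi] hB.
have B0 : 0 <= B by apply: le_trans (hB 0%N); exact: normc_ge0.
rewrite -ler_sqr ?nnegrE ?normc_ge0 //.
have h k : complex.Re (f k) ^+ 2 + complex.Im (f k) ^+ 2 <= B ^+ 2.
  have := hB k; rewrite -ler_sqr ?nnegrE ?normc_ge0 //.
  by case: (f k) => a b /=; rewrite sqr_sqrtr ?addr_ge0 ?sqr_ge0.
have {h}: complex.Re l ^+ 2 + complex.Im l ^+ 2 <= B ^+ 2.
  have hc : (fun k => complex.Re (f k) ^+ 2 + complex.Im (f k) ^+ 2) @ \oo -->
      complex.Re l ^+ 2 + complex.Im l ^+ 2.
    by apply: cvgD; rewrite expr2; under eq_fun do rewrite expr2; exact: cvgM.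
  by apply: (cvgr_to_le hc); exact: nearW.
by case: l {fr fi} => a b /=; rewrite sqr_sqrtr ?addr_ge0 ?sqr_ge0.
Qed.

Definition exp_psum z k : R[i] := \sum_(m < k) (m`!%:R)^-1 * z ^+ m.

Lemma exp_coeff_imag (t : R) m : (m`!%:R)^-1 * (0 -i* t) ^+ m
  = cos_coeff t m -i* sin_coeff t m.
Proof.
have sq : (0 -i* t) ^+ 2 = (- t ^+ 2)%:C.
  by rewrite expr2; simpc; congr (_ +i* _); ring.
have fact : (m`!%:R : R[i])^-1 = ((m`!%:R)^-1)%:C by rewrite fmorphV rmorph_nat.
rewrite fact /cos_coeff /sin_coeff /=.
(* Split by parity: even powers of -it are real and feed the cosine, odd powers the sine. *)
have [h [b ->]] : exists h (b : bool), m = (b + h.*2)%N.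
  by exists m./2, (odd m); rewrite odd_double_half.
have -> : (0 -i* t) ^+ (b + h.*2) = (0 -i* t) ^+ b * ((-1) ^+ h * t ^+ h.*2)%:C.
  by rewrite exprD -mul2n !exprM sq -rmorphXn -exprMn mulN1r.
rewrite -exprnP; move: (_`!%:R^-1) => q.
rewrite [t ^+ (b + _)]exprD oddD odd_double addbF.
case: b; rewrite /= ?add0n ?add1n /= doubleK ?expr0 ?expr1; simpc;
 by congr (_ +i* _); ring.
Qed.

Lemma ccvg_exp_psum t : ccvg (exp_psum (0 -i* t)) (cis t).
Proof.
have hRe k : complex.Re (exp_psum (0 -i* t) k) = series (cos_coeff t) k.
  rewrite seriesEord /exp_psum /=; elim: k => [|k IH].
    by rewrite !big_ord0.
  rewrite !big_ord_recr /= -IH exp_coeff_imag.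
  by case: (\sum_(_ < _) _).
have hIm k : complex.Im (exp_psum (0 -i* t) k) = - series (sin_coeff t) k.
  rewrite seriesEord /exp_psum /=; elim: k => [|k IH].
    by rewrite !big_ord0 oppr0.
  rewrite !big_ord_recr /= opprD -IH exp_coeff_imag.
  by case: (\sum_(_ < _) _).
split.
  under eq_fun do rewrite hRe.
  by rewrite /cis /= unlock; exact: is_cvg_series_cos_coeff.
under eq_fun do rewrite hIm.
by rewrite /cis /= unlock; apply: cvgN; exact: is_cvg_series_sin_coeff.
Qed.

End ComplexLimits.

(** * Exponential of a diagonalized matrix *)

Section MatrixExponential.
Variables (R : realType) (N : nat).
Implicit Types (A P Q : 'M[R[i]]_N) (d e : 'rV[R[i]]_N).

Lemma conj_diagE P d Q x y :
  (P *m diag_mx d *m Q) x y = \sum_j P x j * d 0 j * Q j y.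
Proof.
rewrite mxE; apply: eq_bigr => j _; congr (_ * _).
by rewrite mul_mx_diag mxE.
Qed.

Lemma conj_diagX P d Q m : Q *m P = 1%:M ->
  (P *m diag_mx d *m Q) ^+ m = P *m diag_mx (\row_j d 0 j ^+ m) *m Q.
Proof.
move=> QP; elim: m => [|m IH].
  have -> : diag_mx (\row_j d 0 j ^+ 0) = 1%:M.
    by apply/matrixP => i j; rewrite !mxE expr0.
  by rewrite mulmx1 (mulmx1C QP) expr0.
rewrite exprS IH -mulmxE !mulmxA; congr (_ *m _).
rewrite -[_ *m Q *m P]mulmxA QP mulmx1 -mulmxA mulmx_diag.
congr (_ *m diag_mx _).
by apply/rowP => j; rewrite !mxE exprS.
Qed.

Lemma mxexp_psum_conj_diag P d Q k x y : Q *m P = 1%:M ->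
  mxexp_psum (P *m diag_mx d *m Q) k x y
  = \sum_j P x j * exp_psum (d 0 j) k * Q j y.
Proof.
move=> QP; rewrite /mxexp_psum summxE.
under eq_bigr do rewrite mxE conj_diagX // conj_diagE mulr_sumr.
rewrite exchange_big; apply: eq_bigr => j _ /=.
rewrite mulr_sumr mulr_suml; apply: eq_bigr => m _.
by rewrite mxE !mulrA [_ * P x j]mulrC.
Qed.

(** The second clause records true convergence, through which bounds on partial sums later pass to
    [mxexp]. *)
Lemma mxexp_conj_diag P Q (d : 'I_N -> R) t : Q *m P = 1%:M ->
  let A := P *m diag_mx (\row_j (d j)%:C) *m Q in
  mxexp ((0 -i* t) *: A) = P *m diag_mx (\row_j cis (t * d j)) *m Q
  /\ forall x y, ccvg (fun k => mxexp_psum ((0 -i* t) *: A) k x y)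
                      (mxexp ((0 -i* t) *: A) x y).
Proof.
move=> QP A.
have AE : (0 -i* t) *: A = P *m diag_mx (\row_j (0 -i* (t * d j))) *m Q.
  rewrite /A scalemxAl scalemxAr; congr (_ *m _ *m _).
  apply/matrixP => i j; rewrite !mxE; case: eqP => _.
    by rewrite !mulr1n; simpc; rewrite ?mulNr.
  by rewrite !mulr0n mulr0.
have cvgA x y : ccvg (fun k => mxexp_psum ((0 -i* t) *: A) k x y)
    ((P *m diag_mx (\row_j cis (t * d j)) *m Q) x y).
  rewrite AE conj_diagE.
  under eq_fun do rewrite mxexp_psum_conj_diag //.
  apply: ccvg_sum => j; rewrite !mxE.
  under eq_fun do rewrite mulrAC.
  by rewrite mulrAC; apply: ccvgM; exact: ccvg_exp_psum.
have E : mxexp ((0 -i* t) *: A) = P *m diag_mx (\row_j cis (t * d j)) *m Q.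
  by apply/matrixP => x y; rewrite mxE; exact: ccvg_lim (cvgA x y).
by split=> // x y; rewrite E.
Qed.

End MatrixExponential.

(** * Diagonal forms of the Hamiltonians *)

Section BasisIndex.
Variable n : nat.

Lemma sum_rank (V : nmodType) (F : 'I_(qdim n) -> V) :
  \sum_i F i = \sum_(x : bits n) F (enum_rank x).
Proof. exact/reindex/onW_bij/enum_rank_bij. Qed.

End BasisIndex.

Section Spectral.
Variables (R : realType) (N : nat).

(** The basis vector of index [i] attains |d i|. The supremum dominates it because the set is
    bounded, for which the sum of all |d j| is bound enough. *)
Lemma specnorm_diag_ge (d : 'I_N -> R) i :
  `|d i| <= specnorm (diag_mx (\row_j (d j)%:C)).
Proof.
have E (v : 'cV[R[i]]_N) j :
    normc ((diag_mx (\row_j (d j)%:C) *m v) j 0) = `|d j| * normc (v j 0).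
  by rewrite mul_diag_mx !mxE normcM normc_real.
apply: ub_le_sup.
  exists (\sum_j `|d j|) => _ [v /= hv <-].
  have d0 : 0 <= \sum_j `|d j| by apply: sumr_ge0.
  apply: le_trans (_ : (\sum_j `|d j|) * l2norm v <= _); last first.
    by rewrite ler_piMr.
  rewrite -[X in X * _]ger0_norm // -sqrtr_sqr /l2norm -sqrtrM ?sqr_ge0 //.
  rewrite ler_wsqrtr // mulr_sumr ler_sum // => j _.
  rewrite E exprMn ler_wpM2r ?sqr_ge0 // ler_sqr ?nnegrE //.
  by rewrite (bigD1 j) //= lerDl sumr_ge0.
exists (delta_mx i 0) => /=; rewrite /l2norm.
  rewrite (bigD1 i) //= big1 => [|j /negPf ji].
    by rewrite mxE !eqxx normc1 expr1n addr0 sqrtr1.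
  by rewrite mxE ji andFb mulr0n normc0 expr0n.
rewrite (bigD1 i) //= big1 => [|j /negPf ji].
  by rewrite E mxE !eqxx normc1 mulr1 addr0 sqrtr_sqr normr_id.
by rewrite E mxE ji andFb mulr0n normc0 mulr0 expr0n.
Qed.

End Spectral.

Section Hamiltonians.
Variables (R : realType) (n : nat).
Local Notation N := (qdim n).
Local Notation er := (@enum_rank (bits n)).

Lemma costH_diag (c : bits n -> R) :
  costH c = diag_mx (\row_i (c (enum_val i))%:C).
Proof.
apply/matrixP => i j; rewrite /costH summxE (bigD1 (enum_val i)) //=.
rewrite /ket trmx_delta mul_delta_mx !mxE enum_valK eqxx /=.
rewrite big1 ?addr0 => [|x hx].
  by rewrite eq_sym; case: (i == j); rewrite ?mulr1n ?mulr0n ?mulr1 ?mulr0.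
rewrite trmx_delta mul_delta_mx !mxE; case: eqP => [hi|]; last by rewrite mulr0.
by move: hx; rewrite hi enum_rankK eqxx.
Qed.

Lemma costHZ_diag (c : bits n -> R) :
  costHZ c = diag_mx (\row_i (c (enum_val i) - cost_mean c)%:C).
Proof.
rewrite /costHZ costH_diag; apply/matrixP => i j; rewrite !mxE rmorphB.
by case: eqP; rewrite ?mulr1n ?mulr0n ?subr0.
Qed.

Lemma mixer_mulE m (A : 'M[R[i]]_(N, m)) x k :
  (mixer R n *m A) (er x) k = \sum_j A (er (flip j x)) k.
Proof.
rewrite /mixer mulmx_suml summxE; apply: eq_bigr => j _.
rewrite mulmx_suml summxE (bigD1 (flip j x)) //= big1 ?addr0 => [|y hy].
  rewrite /ket trmx_delta -mulmxA -rowE flipK.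
  by rewrite mxE big_ord1 !mxE !eqxx mul1r.
rewrite /ket trmx_delta -mulmxA -rowE mxE big_ord1 !mxE.
rewrite (inj_eq enum_rank_inj); case: eqP => [hx|]; last by rewrite mul0r.
by move: hy; rewrite hx flipK eqxx.
Qed.

(** The character (-1)^(x.z), written as a product so that a flip changes a single factor. *)
Definition walsh (x z : bits n) : R := \prod_k (-1) ^+ (x k && z k).

Lemma walshC x z : walsh x z = walsh z x.
Proof. by apply: eq_bigr => k _; rewrite andbC. Qed.

Lemma walsh_flip j x z : walsh (flip j x) z = (-1) ^+ z j * walsh x z.
Proof.
rewrite /walsh !(bigD1 j (P := predT)) //= mulrA; congr (_ * _); last first.
  by apply: eq_bigr => k /negPf kj; rewrite ffunE kj.
by rewrite ffunE eqxx; case: (x j); case: (z j) => /=; ring.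
Qed.

Lemma walsh_orth x y : \sum_z walsh x z * walsh z y = 2 ^+ n * (x == y)%:R.
Proof.
(* Exchanging sum and product leaves one factor per bit: 1 - 1 = 0 where x and y differ, 2
   elsewhere. *)
transitivity (\prod_k \sum_(b : bool)
    ((-1) ^+ (x k && b) * (-1) ^+ (b && y k)) : R).
  rewrite bigA_distr_bigA; apply: eq_bigr => z _.
  by rewrite -big_split.
have [->|/eqP xy] := eqVneq x y.
  rewrite mulr1 -[in RHS](card_ord n) -prodr_const; apply: eq_bigr => k _.
  by rewrite big_bool; case: (y k) => /=; ring.
have [k hk] : exists k, x k != y k.
  apply/existsP; rewrite -negb_forall; apply/forallP => h; apply: xy.
  by apply/ffunP => k; apply/eqP.
rewrite mulr0 (bigD1 k) //= big_bool.
by move: hk; case: (x k); case: (y k) => //= _; ring.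
Qed.

Definition hadamard : 'M[R[i]]_N :=
  \matrix_(i, j) ((Num.sqrt (2 ^+ n))^-1 * walsh (enum_val i) (enum_val j))%:C.

Lemma hadamardK : hadamard *m hadamard = 1%:M.
Proof.
apply/matrixP => i j; rewrite !mxE sum_rank.
rewrite (eq_bigr (fun z => ((2 ^+ n)^-1
    * (walsh (enum_val i) z * walsh z (enum_val j)))%:C)) => [|z _].
  rewrite -rmorph_sum -mulr_sumr walsh_orth mulKf ?expf_neq0 ?pnatr_eq0 //.
  by rewrite (inj_eq enum_val_inj) rmorph_nat.
rewrite !mxE enum_rankK -rmorphM; congr (_%:C).
by rewrite mulrACA -invfM -expr2 sqr_sqrtr ?exprn_ge0.
Qed.

(** Equals n minus twice the Hamming weight of z. *)
Definition mixer_eig (z : bits n) : R := \sum_j (-1) ^+ z j.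

(** As [hadamard] is its own inverse, it suffices that its columns are eigenvectors of B, which is
    [walsh_flip] summed over the positions. *)
Lemma mixer_conj_diag : mixer R n
  = hadamard *m diag_mx (\row_i (mixer_eig (enum_val i))%:C) *m hadamard.
Proof.
rewrite -[LHS]mulmx1 -hadamardK mulmxA; congr (_ *m _).
apply/matrixP => i j; rewrite -(enum_valK i) -(enum_valK j).
move: (enum_val i) (enum_val j) => x z.
rewrite mixer_mulE mul_mx_diag !mxE !enum_rankK -rmorphM.
under eq_bigr do rewrite !mxE !enum_rankK walsh_flip.
rewrite -rmorph_sum; congr (_%:C); rewrite mulr_sumr.
by apply: eq_bigr => k _; ring.
Qed.

End Hamiltonians.

(** * First order of the mixer evolution *)

Section MixerEvolution.
Variables (R : realType) (n : nat) (beta : R).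
Local Notation N := (qdim n).
Local Notation er := (@enum_rank (bits n)).
Local Notation U := (mxexp ((0 -i* beta) *: mixer R n)).
Local Notation b := (n%:R * `|beta|).

Lemma mixer_expE : U = hadamard R n
  *m diag_mx (\row_i cis (beta * mixer_eig R (enum_val i))) *m hadamard R n.
Proof.
by rewrite mixer_conj_diag (mxexp_conj_diag _ _ (hadamardK R n)).1.
Qed.

Lemma ccvg_mixer_exp m (A : 'M[R[i]]_(N, m)) x k :
  ccvg (fun l => (mxexp_psum ((0 -i* beta) *: mixer R n) l *m A) x k)
       ((U *m A) x k).
Proof.
rewrite mxE; under eq_fun do rewrite mxE.
apply: ccvg_sum => j; under eq_fun do rewrite mulrC.
rewrite mulrC; apply: ccvgM.
rewrite mixer_conj_diag; exact: (mxexp_conj_diag _ _ (hadamardK R n)).2.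
Qed.

(** Every row of B has n entries 1, so the all-ones vector is an eigenvector of eigenvalue n. *)
Lemma mixer_exp_const1 :
  U *m const_mx 1 = cis (beta * n%:R) *: (const_mx 1 : 'cV_N).
Proof.
apply/matrixP => x k; have := ccvg_mixer_exp (const_mx 1 : 'cV_N) x k.
move/ccvg_unique; apply.
have E m : ((0 -i* beta) *: mixer R n) ^+ m *m (const_mx 1 : 'cV_N)
    = (0 -i* (beta * n%:R)) ^+ m *: const_mx 1.
  elim: m => [|m IH]; first by rewrite mul1mx scale1r.
  rewrite exprSr -mulmxA.
  have -> : (0 -i* beta) *: mixer R n *m const_mx 1
      = (0 -i* (beta * n%:R)) *: (const_mx 1 : 'cV_N).
    apply/matrixP => i j; rewrite -scalemxAl mxE -(enum_valK i) mixer_mulE.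
    under eq_bigr do rewrite mxE.
    rewrite sumr_const card_ord !mxE mulr1 -(rmorph_nat (real_complex R) n).
    by simpc; rewrite ?mulNr.
  by rewrite -scalemxAr IH scalerA -exprS.
rewrite !mxE mulr1.
have := @ccvg_exp_psum R (beta * n%:R); congr ccvg; apply/funext => l.
rewrite /mxexp_psum mulmx_suml summxE; apply: eq_bigr => m _.
by rewrite -scalemxAl E !mxE mulr1.
Qed.

(** An entry of B w sums n entries of w, so each factor beta B costs at most [b]. *)
Lemma mixerX_bound m (w : 'cV[R[i]]_N) (g : R) :
  (forall i, normc (w i 0) <= g) ->
  forall i, normc ((((0 -i* beta) *: mixer R n) ^+ m *m w) i 0) <= b ^+ m * g.
Proof.
move=> wg; elim: m => [|m IH] i; first by rewrite mul1mx expr0 mul1r.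
rewrite exprS -mulmxA -scalemxAl mxE normcM -(enum_valK i) mixer_mulE.
have -> : normc (0 -i* beta) = `|beta|.
  by rewrite /= expr0n add0r sqrrN sqrtr_sqr.
rewrite exprS -!mulrA mulrCA ler_wpM2l //.
apply: (le_trans (normc_sum _ _)).
apply: (le_trans (ler_sum _ (fun j _ => IH _))).
by rewrite sumr_const card_ord -[leLHS]mulr_natl.
Qed.

(** Consecutive terms have ratio at most x/3, so the sum is at most x^2/2 + (x/3) S, with S one term
    shorter. The induction closes as 1/2 + (2/15)(3/5) = 29/50 < 3/5. *)
Lemma exp_tail_le (x : R) k : 0 <= x <= 2 / 5 ->
  \sum_(m < k) x ^+ m.+2 / m.+2`!%:R <= 3 / 5 * x ^+ 2.
Proof.
move=> /andP[x0 x1]; elim: k => [|k IH].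
  by rewrite big_ord0 mulr_ge0 ?exprn_ge0.
rewrite big_ord_recl /=.
apply: le_trans (_ : x ^+ 2 / 2 + x / 3 *
    (\sum_(m < k) x ^+ m.+2 / m.+2`!%:R) <= _).
  rewrite lerD2l mulr_sumr ler_sum // => m _; rewrite /bump /= add1n.
  have -> : x ^+ m.+3 / m.+3`!%:R
      = x / m.+3%:R * (x ^+ m.+2 / m.+2`!%:R).
    by rewrite exprS factS natrM invfM; ring.
  rewrite ler_wpM2r ?divr_ge0 ?exprn_ge0 // ler_wpM2l // lef_pV2 ?posrE //.
  by rewrite ler_nat.
have x2 := exprn_ge0 2 x0.
have y0 : 0 <= x / 3 by lra.
have := ler_wpM2l y0 IH.
have : x / 3 * (3 / 5 * x ^+ 2) <= 2 / 15 * (3 / 5 * x ^+ 2).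
  by rewrite ler_wpM2r ?mulr_ge0 //; lra.
by lra.
Qed.

(* b bounds the norm of beta B on the sup norm, so the tail of the exponential
   series from order 2 on is at most sum_(m >= 2) b^m / m!. *)
Lemma mixer_exp_approx (w : 'cV[R[i]]_N) (g : R) x :
  b <= 2 / 5 -> (forall i, normc (w i 0) <= g) -> w (er x) 0 = 0 ->
  normc ((U *m w) (er x) 0 - (0 -i* beta) * \sum_j w (er (flip j x)) 0)
  <= 3 / 5 * b ^+ 2 * g.
Proof.
move=> hb wg w0.
have b0 : 0 <= b by rewrite mulr_ge0.
have g0 : 0 <= g by apply: le_trans (wg (er x)); exact: normc_ge0.
set L := (0 -i* beta) * _.
pose A := (0 -i* beta) *: mixer R n.
(* The shift by 2 puts orders 0 and 1 in every partial sum: the first vanishes as w is 0 at x, the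
   second is [L]. *)
pose f k := (mxexp_psum A (k + 2) *m w) (er x) 0 - L.
have fE k : f k = \sum_(m < k) ((m.+2`!%:R)^-1 * (A ^+ m.+2 *m w) (er x) 0).
  have psumE l : (mxexp_psum A l *m w) (er x) 0
      = \sum_(m < l) ((m`!%:R)^-1 * (A ^+ m *m w) (er x) 0).
    rewrite /mxexp_psum mulmx_suml summxE; apply: eq_bigr => m _.
    by rewrite -scalemxAl mxE.
  rewrite /f psumE addn2 !big_ord_recl /= expr0 mul1mx w0 mulr0 add0r expr1.
  have -> : (A *m w) (er x) 0 = L by rewrite -scalemxAl mxE mixer_mulE.
  by rewrite invr1 mul1r addrAC subrr add0r.
have fL : ccvg f ((U *m w) (er x) 0 - L).
  apply: ccvgD (ccvg_cst _).
  have [hr hi] := ccvg_mixer_exp w (er x) 0.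
  split.
    by rewrite (cvg_shiftn 2
      (fun l => complex.Re ((mxexp_psum A l *m w) (er x) 0))).
  by rewrite (cvg_shiftn 2
      (fun l => complex.Im ((mxexp_psum A l *m w) (er x) 0))).
apply: (ccvg_normc_le fL) => k; rewrite fE.
apply: (le_trans (normc_sum _ _)).
apply: le_trans (_ : \sum_(m < k) b ^+ m.+2 / m.+2`!%:R * g <= _).
  apply: ler_sum => m _; rewrite normcM mulrAC [leRHS]mulrC.
  have -> : normc (m.+2`!%:R)^-1 = (m.+2`!%:R)^-1 :> R.
    rewrite normcV -(rmorph_nat (real_complex R)) normc_real ger0_norm //.
  by rewrite ler_wpM2l // mixerX_bound.
by rewrite -mulr_suml ler_wpM2r // exp_tail_le // b0.
Qed.

End MixerEvolution.

(** * Norm preservation *)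

Section Isometries.
Variables (R : realType) (n : nat).
Local Notation N := (qdim n).

Lemma braketE m (u v : 'cV[R[i]]_m) : braket u v = \sum_i (u i 0)^* * v i 0.
Proof. by rewrite /braket mxE; apply: eq_bigr => i _; rewrite !mxE. Qed.

Lemma braket_norm m (u : 'cV[R[i]]_m) :
  braket u u = (\sum_i normc (u i 0) ^+ 2)%:C.
Proof.
rewrite braketE rmorph_sum; apply: eq_bigr => i _; exact/esym/sqr_normc_mul.
Qed.

Lemma braket_diag_cis m (d : 'I_m -> R) (u : 'cV[R[i]]_m) :
  let D := diag_mx (\row_i cis (d i)) in braket (D *m u) (D *m u) = braket u u.
Proof.
rewrite /= !braket_norm; congr (_%:C); apply: eq_bigr => i _.
by rewrite mul_diag_mx !mxE normcM normc_cis mul1r.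
Qed.

(** The matrix is real, symmetric and its own inverse, hence unitary. *)
Lemma braket_hadamard (u : 'cV[R[i]]_N) :
  braket (hadamard R n *m u) (hadamard R n *m u) = braket u u.
Proof.
rewrite /braket map_mxM trmx_mul -mulmxA [X in _ *m X]mulmxA.
have -> : (map_mx (@conjc R) (hadamard R n))^T = hadamard R n.
  by apply/matrixP => i j; rewrite !mxE conjc_real walshC.
by rewrite hadamardK mul1mx.
Qed.

End Isometries.

(** * Probabilities and mean of QAOA *)

Section QAOA.
Variables (R : realType) (n : nat) (c : bits n -> R) (gamma beta : R).
Local Notation N := (qdim n).
Local Notation er := (@enum_rank (bits n)).
Local Notation U := (mxexp ((0 -i* beta) *: mixer R n)).
Local Notation b := (n%:R * `|beta|).
Local Notation psi := (qaoa1_state c gamma beta).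

Definition phases : 'cV[R[i]]_N := \col_i cis (gamma * c (enum_val i)).

Lemma costH_expE : mxexp ((0 -i* gamma) *: costH c)
  = diag_mx (\row_i cis (gamma * c (enum_val i))).
Proof.
have := (mxexp_conj_diag (fun i => c (enum_val i)) gamma
  (mulmx1 (1%:M : 'M[R[i]]_N))).1.
by rewrite -costH_diag !mul1mx !mulmx1.
Qed.

Lemma plus_stateE :
  plus_state R n = ((Num.sqrt (2 ^+ n))^-1)%:C *: const_mx 1.
Proof.
congr (_ *: _); apply/matrixP => i j; rewrite summxE (bigD1 (enum_val i)) //=.
rewrite !mxE enum_valK eqxx ord1 /= big1 ?addr0 // => x hx; rewrite mxE.
by case: eqP => // hi; move: hx; rewrite hi enum_rankK eqxx.
Qed.

Lemma qaoa1_stateE : psi = ((Num.sqrt (2 ^+ n))^-1)%:C *: (U *m phases).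
Proof.
rewrite /qaoa1_state costH_expE plus_stateE -!scalemxAr; congr (_ *: (_ *m _)).
by apply/matrixP => i j; rewrite mul_diag_mx !mxE mulr1.
Qed.

Lemma qaoa1_prob_amp x : qaoa1_prob c gamma beta x = normc (psi (er x) 0) ^+ 2.
Proof.
congr (normc _ ^+ 2); rewrite /braket.
have -> : map_mx (@conjc R) (ket R x) = ket R x.
  by apply/matrixP => i j; rewrite !mxE conjc_nat.
by rewrite trmx_delta -rowE mxE.
Qed.

Lemma qaoa1_probE x : qaoa1_prob c gamma beta x
  = (2 ^+ n)^-1 * normc ((U *m phases) (er x) 0) ^+ 2.
Proof.
rewrite qaoa1_prob_amp qaoa1_stateE mxE normcM normc_real exprMn.
rewrite real_normK ?num_real //.
by rewrite exprVn sqr_sqrtr // exprn_ge0.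
Qed.

(** The state arises from |s> by Hadamard matrices and diagonal phases, all norm preserving. *)
Lemma sum_qaoa1_prob : \sum_x qaoa1_prob c gamma beta x = 1.
Proof.
apply: complexI; transitivity (braket psi psi).
  rewrite braket_norm sum_rank; congr (_%:C).
  by apply: eq_bigr => x _; rewrite qaoa1_prob_amp.
rewrite /qaoa1_state mixer_expE -!mulmxA braket_hadamard braket_diag_cis.
rewrite braket_hadamard costH_expE braket_diag_cis braket_norm; congr (_%:C).
rewrite sum_rank (eq_bigr (fun=> (2 ^+ n)^-1)) => [|x _].
  rewrite sumr_const card_ffun card_bool card_ord -[LHS]mulr_natl natrX.
  by rewrite divff // expf_neq0 // pnatr_eq0.
rewrite plus_stateE !mxE mulr1 normc_real real_normK ?num_real //.
by rewrite exprVn sqr_sqrtr // exprn_ge0.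
Qed.

Lemma braket_costH (p : 'cV[R[i]]_N) :
  braket p (costH c *m p) = (\sum_x normc (p (er x) 0) ^+ 2 * c x)%:C.
Proof.
rewrite braketE sum_rank rmorph_sum; apply: eq_bigr => x _.
rewrite costH_diag mul_diag_mx !mxE enum_rankK rmorphM /=.
by rewrite sqr_normc_mul mulrCA mulrC.
Qed.

Lemma qaoa1_meanE :
  qaoa1_mean c gamma beta = (\sum_x qaoa1_prob c gamma beta x * c x)%:C.
Proof.
rewrite /qaoa1_mean /= braket_costH; congr (_%:C).
by apply: eq_bigr => x _; rewrite qaoa1_prob_amp.
Qed.

Variable g : R.
Hypotheses (g0 : 0 <= g) (g1 : g <= 1) (bg : b <= 2 / 5 * g ^+ 2).
Hypothesis cg : forall x y, `|gamma * (c y - c x)| <= g.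

Lemma qaoa1_prob_approx x :
  `|class_prob c gamma beta x - qaoa1_prob c gamma beta x|
  <= 9 / 10 * g ^+ 4 / 2 ^+ n.
Proof.
pose u y := gamma * (c y - c x).
pose w : 'cV[R[i]]_N := \col_i (cis (u (enum_val i)) - 1).
have wE y : w (er y) 0 = cis (u y) - 1 by rewrite mxE enum_rankK.
have wg i : normc (w i 0) <= g.
  by rewrite mxE; apply: le_trans (normcB_cis1 _) _; exact: cg.
have g2 : g ^+ 2 <= 1 by rewrite expr_le1.
(* An opaque name for b: [lra] fails on the product defining it. *)
have [B BE] : exists B : R, B = b by exists b.
have b0 : 0 <= B by rewrite BE mulr_ge0.
have bG : B <= 2 / 5 * g ^+ 2 by rewrite BE.
have b1 : B <= 2 / 5 by lra.
(* W is the effect of the mixer on w at x and L its first order in beta. *)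
pose W := (U *m w) (er x) 0.
pose L := (0 -i* beta) * \sum_j w (er (flip j x)) 0.
have WL : normc (W - L) <= 3 / 5 * B ^+ 2 * g.
  rewrite BE; apply: mixer_exp_approx; rewrite -?BE //.
  by rewrite wE /u subrr mulr0 cis0 subrr.
have Lg : normc L <= B * g.
  rewrite normcM.
  have -> : normc (0 -i* beta) = `|beta|.
    by rewrite /= expr0n add0r sqrrN sqrtr_sqr.
  rewrite BE [b]mulrC -mulrA ler_wpM2l //; apply: (le_trans (normc_sum _ _)).
  apply: (le_trans (ler_sum _ (fun j _ => wg _))).
  by rewrite sumr_const card_ord -[leLHS]mulr_natl.
(* Termwise, Re (-i beta (e^{-iu} - 1)) = -beta sin u. *)
have ReL : complex.Re L = - beta * \sum_j sin (u (flip j x)).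
  rewrite /L; under eq_bigr do rewrite wE.
  elim/big_rec2 : _ => [|j y z _ IH]; first by simpc.
  rewrite mulrDr; move: IH; case: ((0 -i* beta) * z) => p q /= ->.
  by rewrite /cis; simpc => /=; ring.
pose th := beta * n%:R.
(* The phases e^{-i gamma c(x)} and e^{-i th} have modulus 1 and drop out of the probability. *)
have rhoE : qaoa1_prob c gamma beta x
    = (2 ^+ n)^-1 * normc (1 + cis (- th) * W) ^+ 2.
  rewrite qaoa1_probE; congr (_ * _ ^+ 2).
  have -> : phases = cis (gamma * c x) *: (const_mx 1 + w).
    apply/matrixP => i k; rewrite !mxE addrC subrK -cisD; congr cis.
    by rewrite /u; ring.
  rewrite -scalemxAr mulmxDr mixer_exp_const1.
  have E (a t : R[i]) (p : 'cV[R[i]]_N) i :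
      (a *: (t *: const_mx 1 + p)) i 0 = a * (t + p i 0).
    by rewrite !mxE mulr1.
  rewrite E normcM normc_cis mul1r -/W.
  have -> : cis th + W = cis th * (1 + cis (- th) * W).
    by rewrite mulrDr mulr1 mulrA -cisD subrr cis0 mul1r.
  by rewrite normcM normc_cis mul1r.
pose Z := cis (- th) * W; rewrite -/Z in rhoE.
(* 8/5 = 3/5 + 1: the higher orders from [WL], and the replacement of [cis (- th)] by 1 in front of
   [L], which costs |th| = B times B g. *)
have ZL : `|complex.Re Z - complex.Re L| <= 8 / 5 * B ^+ 2 * g.
  rewrite -ReB.
  apply: le_trans (norm_Re_le _) _.
  have -> : Z - L = (cis (- th) - 1) * L + cis (- th) * (W - L).
    by rewrite /Z; ring.
  apply: (le_trans (le_normcD _ _)).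
  rewrite (normcM (_ - 1)) (normcM (cis _) (W - L)) normc_cis mul1r.
  have : normc (cis (- th) - 1) * normc L <= B * (B * g).
    apply: ler_pM; rewrite ?normc_ge0 //; apply: le_trans (normcB_cis1 _) _.
    by rewrite normrN normrM mulrC normr_nat BE.
  by move: WL; rewrite expr2; lra.
(* 31/25 = 1 + (3/5)(2/5), from [Lg] and from [WL] with one factor B bounded by 2/5. *)
have Zg : normc Z <= 31 / 25 * B * g.
  rewrite normcM normc_cis mul1r -(subrK L W).
  apply: (le_trans (le_normcD _ _)).
  have : 3 / 5 * B ^+ 2 * g <= 3 / 5 * (B * (2 / 5)) * g.
    by rewrite ler_wpM2r // ler_wpM2l // expr2 ler_wpM2l.
  by lra.
have Lin : `|complex.Re L - beta * gamma * \sum_j (c x - c (flip j x))|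
    <= B * (g ^+ 3 / 6).
  have -> : complex.Re L - beta * gamma * \sum_j (c x - c (flip j x))
      = - beta * \sum_j (sin (u (flip j x)) - u (flip j x)).
    rewrite ReL [in RHS]sumrB mulrBr; congr (_ - _).
    by rewrite !mulr_sumr; apply: eq_bigr => j _; rewrite /u; ring.
  rewrite normrM normrN BE [b]mulrC -mulrA ler_wpM2l //.
  apply: (le_trans (ler_norm_sum _ _ _)).
  apply: (le_trans (ler_sum _ (fun j _ => norm_sinB_le _))).
  apply: le_trans (_ : \sum_(j < n) g ^+ 3 / 6 <= _).
    apply: ler_sum => j _.
    by rewrite ler_wpM2r // lerXn2r ?nnegrE //; exact: cg.
  by rewrite sumr_const card_ord -[leLHS]mulr_natl.
(* In units of g^4: 2/15 for the sines, (16/5)(4/25) for the rest of 2 Re Z, (31/25)^2 (4/25) for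
   |Z|^2; in all about 0.891 < 9/10. *)
have rhoZ : `|1 + 2 * beta * gamma * \sum_j (c x - c (flip j x))
    - normc (1 + Z) ^+ 2| <= 9 / 10 * g ^+ 4.
  rewrite sqr_normc1D.
  have h1 : `|2 * beta * gamma * \sum_j (c x - c (flip j x))
      - 2 * complex.Re Z|
      <= 2 * (B * (g ^+ 3 / 6)) + 16 / 5 * B ^+ 2 * g.
    move: ZL Lin; rewrite !ler_norml => /andP[? ?] /andP[? ?].
    by apply/andP; split; lra.
  have h2 : normc Z ^+ 2 <= (31 / 25) ^+ 2 * B ^+ 2 * g ^+ 2.
    by rewrite -!exprMn lerXn2r ?nnegrE ?normc_ge0 // !mulr_ge0.
  have bb : B ^+ 2 <= 4 / 25 * g ^+ 4.
    have -> : 4 / 25 * g ^+ 4 = (2 / 5 * g ^+ 2) ^+ 2 by field.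
    by rewrite lerXn2r ?nnegrE // mulr_ge0 // exprn_ge0.
  have g4 : 0 <= g ^+ 4 by rewrite exprn_ge0.
  have h3 : B ^+ 2 * g <= 4 / 25 * g ^+ 4.
    by rewrite (le_trans _ bb) // ler_piMr ?exprn_ge0.
  have h4 : B ^+ 2 * g ^+ 2 <= 4 / 25 * g ^+ 4.
    by rewrite (le_trans _ bb) // ler_piMr ?exprn_ge0.
  have h5 : B * (g ^+ 3 / 6) <= g ^+ 4 / 15.
    apply: le_trans (_ : 2 / 5 * g ^+ 2 * (g ^+ 3 / 6) <= _).
      by rewrite ler_wpM2r // divr_ge0 ?exprn_ge0.
    have -> : 2 / 5 * g ^+ 2 * (g ^+ 3 / 6) = g ^+ 4 / 15 * g by field.
    by rewrite ler_piMr // divr_ge0.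
  have Z0 : 0 <= normc Z ^+ 2 by rewrite sqr_ge0.
  by move: h1; rewrite !ler_norml => /andP[? ?]; apply/andP; split; lra.
rewrite rhoE /class_prob -mulrBr normrM ger0_norm ?invr_ge0 ?exprn_ge0 //.
by rewrite [leRHS]mulrC ler_wpM2l // invr_ge0 exprn_ge0.
Qed.

End QAOA.

(** * Comparison of means and assembly *)

Lemma powR_quarter_exp4 (R : realType) (eps : R) : 0 <= eps ->
  powR eps (1 / 4) ^+ 4 = eps.
Proof.
move=> e0; rewrite -powR_mulrn ?powR_ge0 // -powRrM.
by rewrite (_ : 1 / 4 * 4%:R = 1) ?powRr1 //; field.
Qed.

(** Both weights sum to 1, so [f] may be recentred at [a] without changing the difference of
    means. *)
Lemma dist_mean_le (R : realType) (I : finType) (p q f : I -> R) (a s e : R) :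
  \sum_i p i = 1 -> \sum_i q i = 1 -> (forall i, `|f i - a| <= s) ->
  (forall i, `|p i - q i| <= e) ->
  `|\sum_i p i * f i - \sum_i q i * f i| <= #|I|%:R * (e * s).
Proof.
move=> p1 q1 fs pe.
have -> : \sum_i p i * f i - \sum_i q i * f i
    = \sum_i (p i - q i) * (f i - a).
  under [RHS]eq_bigr do rewrite mulrBr mulrBl.
  by rewrite !sumrB -mulr_suml sumrB p1 q1 subrr mul0r subr0.
apply: (le_trans (ler_norm_sum _ _ _)).
apply: (@le_trans _ _ (\sum_(i in I) e * s)); last first.
  by rewrite sumr_const -[leLHS]mulr_natl.
by apply: ler_sum => i _; rewrite normrM ler_pM.
Qed.

Theorem theorem3p1p1 (R : realType) (c : forall n : nat, bits n -> R)
    (tc : nat -> nat) (tc_poly : poly_bounded tc) (hc : evaluable_in c tc) :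
  exists (A : program) (T : nat -> nat), poly_bounded T /\
    forall (n : nat) (eps gamma beta : R),
      costHZ (c n) != 0 -> costH (c n) != 0 ->
      0 < eps < 1 ->
      `|beta| <= 2 / 5 * (Num.sqrt eps / n%:R) ->
      `|gamma| <= powR eps (1 / 4)
        / (2 * Num.min (specnorm (costHZ (c n))) (specnorm (costH (c n)))) ->
      exists Pclass : bits n -> R,
        [/\ produces A (c n) (tc n) eps gamma beta (T n) Pclass,
            (forall x : bits n,
               `|Pclass x - qaoa1_prob (c n) gamma beta x| <= eps / 2 ^+ n) &
            Normc.normc
              (real_complex R (\sum_x Pclass x * c n x)
                - qaoa1_mean (c n) gamma beta)
              < specnorm (costHZ (c n)) * eps].
Proof.
exists sampler, (fun n => 10 * n + 15 + 2 * tc n)%N; split.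
  apply: poly_boundedD; last exact: poly_boundedMl.
  apply: poly_boundedD (poly_bounded_const 15).
  exact: poly_boundedMl poly_bounded_id.
move=> n eps gamma beta CZ0 C0 /andP[e0 e1] hbeta hgamma.
set s := specnorm (costHZ (c n)) in hgamma *.
set S := specnorm (costH (c n)) in hgamma.
set g := powR eps (1 / 4) in hgamma.
have sZ x : `|c n x - cost_mean (c n)| <= s.
  have := specnorm_diag_ge
    (fun i => c n (enum_val i) - cost_mean (c n)) (enum_rank x).
  by rewrite -costHZ_diag enum_rankK.
have sC x : `|c n x| <= S.
  have := specnorm_diag_ge (fun i => c n (enum_val i)) (enum_rank x).
  by rewrite -costH_diag enum_rankK.
(* All diagonal entries of C_Z are bounded by [s], so [s] = 0 would force C_Z = 0. *)
have s0 : 0 < s.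
  rewrite lt_neqAle (le_trans _ (sZ [ffun=> false])) // andbT.
  apply: contra CZ0 => /eqP sE; apply/eqP; rewrite costHZ_diag.
  apply/matrixP => i j; rewrite !mxE.
  have := sZ (enum_val i); rewrite -sE normr_le0 => /eqP ->.
  by rewrite rmorph0 mul0rn.
have S0 : 0 < S.
  rewrite lt_neqAle (le_trans _ (sC [ffun=> false])) // andbT.
  apply: contra C0 => /eqP sE; apply/eqP; rewrite costH_diag.
  apply/matrixP => i j; rewrite !mxE.
  have := sC (enum_val i); rewrite -sE normr_le0 => /eqP ->.
  by rewrite rmorph0 mul0rn.
clearbody s S.
(* For n = 0 the only bitstring has the mean cost, so C_Z = 0. *)
have n0 : (0 < n)%N.
  rewrite lt0n; apply: contra CZ0 => /eqP n0; apply/eqP; rewrite costHZ_diag.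
  have bits0 (x y : bits n) : x = y.
    by apply/ffunP => k; have := ltn_ord k; rewrite [X in (_ < X)%N]n0.
  have meanE x : cost_mean (c n) = c n x.
    rewrite /cost_mean (eq_bigr (fun=> c n x)) => [|y _]; last exact: congr1.
    rewrite sumr_const card_ffun card_bool card_ord -[_ *+ (2 ^ n)%N]mulr_natl.
    by rewrite natrX mulKf // expf_neq0 // pnatr_eq0.
  apply/matrixP => i j; rewrite !mxE (meanE (enum_val i)).
  by rewrite subrr rmorph0 mul0rn.
have n0' : 0 < n%:R :> R by rewrite ltr0n.
have g0 : 0 <= g by exact: powR_ge0.
have g4 : g ^+ 4 = eps by apply: powR_quarter_exp4; exact: ltW.
have g1 : g <= 1 by rewrite -(ler_pXn2r (n := 4)) ?nnegrE // g4 expr1n ltW.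
have g2 : Num.sqrt eps = g ^+ 2.
  by rewrite -g4 (exprM g 2 2) sqrtr_sqr ger0_norm // exprn_ge0.
have bg : n%:R * `|beta| <= 2 / 5 * g ^+ 2.
  by move: hbeta; rewrite g2 mulrA ler_pdivlMr // mulrC.
(* A cost difference is at most twice either norm: the mean cancels in the bound by [s], and [S]
   bounds each cost directly. *)
have cg x y : `|gamma * (c n y - c n x)| <= g.
  have m0 : 0 < 2 * Num.min s S by rewrite mulr_gt0 ?ltr0n // lt_min s0.
  move: hgamma; rewrite ler_pdivlMr // => h; apply: le_trans h.
  rewrite normrM ler_wpM2l // minr_pMr // le_min; apply/andP; split.
    move: (sZ x) (sZ y); rewrite !ler_norml => /andP[? ?] /andP[? ?].
    by apply/andP; split; lra.
  move: (sC x) (sC y); rewrite !ler_norml => /andP[? ?] /andP[? ?].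
  by apply/andP; split; lra.
(* The coin probability stays within 2/5 of 1/2, so clamping leaves it unchanged. *)
have fp x j : (j < n)%N -> 0 <= flip_prob (c n) gamma beta x j <= 1.
  move=> _; rewrite /flip_prob.
  have : `|n%:R * beta * (gamma * (c n (setb j true x) - c n (setb j false x)))|
      <= 2 / 5.
    rewrite normrM normrM normr_nat -[leRHS]mulr1 ler_pM ?mulr_ge0 //.
      by rewrite (le_trans bg) // ler_piMr // expr_le1.
    exact: le_trans (cg _ _) g1.
  rewrite ler_norml -!mulrA => /andP[? ?]; apply/andP; split; lra.
have approx := qaoa1_prob_approx g0 g1 bg cg; rewrite g4 in approx.
have pow0 : 0 < 2 ^+ n :> R by rewrite exprn_gt0.
exists (class_prob (c n) gamma beta); split.
- exact: sampler_produces.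
- move=> x; apply: le_trans (approx x) _.
  by rewrite ler_wpM2r ?invr_ge0 ?ltW //; lra.
- rewrite qaoa1_meanE -rmorphB normc_real.
  have := dist_mean_le (sum_class_prob (c n) gamma beta)
    (sum_qaoa1_prob (c n) gamma beta) sZ approx.
  move=> /le_lt_trans; apply.
  rewrite card_ffun card_bool card_ord natrX.
  (* The 2^n bitstrings cancel the 2^-n of each error; the factor 9/10 and [s] > 0 give
     strictness. *)
  rewrite [ltLHS](_ : _ = 9 / 10 * (s * eps)); last by field; rewrite gt_eqF.
  by have := mulr_gt0 s0 e0; lra.
Qed.
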